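(* The projections along the $z$ axis on the $(x,y)$-plane of the trajectories of smooth horizontal curves parametrized by arc length in the Heisenberg group $\mathbb{H}$ with constant geodesic curvature are so-called ''Euler spirals'', which are, up to rotations, translations, symmetries and dilations (followed by an affine reparametrization to keep a unitary speed), no more than the trajectory given by $$\mathbb{R}\longrightarrow\mathbb{R}^2,\qquad t\longmapsto\begin{pmatrix}\int_0^t\cos(u^2)\,\mathrm{d}u\\ \int_0^t\sin(u^2)\,\mathrm{d}u\end{pmatrix}.$$
   Context: The Heisenberg group $\mathbb{H}$ is $\mathbb{R}^3$ with coordinates $(x,y,z)$, endowed with the two-dimensional distribution spanned by $X_1=\frac{\partial}{\partial x}-\frac{y}{2}\frac{\partial}{\partial z}$ and $X_2=\frac{\partial}{\partial y}+\frac{x}{2}\frac{\partial}{\partial z}$, with the metric on the distribution for which $(X_1,X_2)$ is an orthonormal frame. A smooth curve is horizontal if it is everywhere tangent to the distribution, and parametrized by arc length if its velocity, expressed in the orthonormal frame $(X_1,X_2)$, has norm $1$ everywhere. For a smooth horizontal curve $\zeta(t)=(x(t),y(t),z(t))$ parametrized by arc length, the characteristic deviation is $h_\zeta(t)=\dot x(t)\ddot y(t)-\dot y(t)\ddot x(t)$, and the geodesic curvature is $k_\zeta(t)=\dot h_\zeta(t)$. The projection along the $z$ axis on the $(x,y)$-plane is the map $\pi:\mathbb{H}\to\mathbb{R}^2$, $\pi(x,y,z)=(x,y)$.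
   Formalization: The constant geodesic curvature is required to be nonzero: when it is zero the characteristic deviation is constant and the projection is a straight line or a circle, e.g. the curve (t,0,0), which is not an Euler spiral. *)

(* Defs.v *)
From Stdlib Require Import Reals.
From Coquelicot Require Import Coquelicot.
Open Scope R_scope.

Definition point2 : Type := (R * R)%type.
Definition point3 : Type := (R * R * R)%type.

Definition xc (p : point3) : R := fst (fst p).
Definition yc (p : point3) : R := snd (fst p).
Definition zc (p : point3) : R := snd p.

Definition X1 (p : point3) : point3 := (1, 0, - (yc p / 2)).
Definition X2 (p : point3) : point3 := (0, 1, xc p / 2).

Definition proj_xy (p : point3) : point2 := (xc p, yc p).

(* Curves are total functions, but all conditions are imposed only on the
   open interval ]a, b[; [a = m_infty] and [b = p_infty] give the whole line.
   [Derive] only depends on the germ of the function, so it is the actual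
   derivative at every point of this open interval. *)
Definition in_itv (a b : Rbar) (t : R) : Prop := Rbar_lt a t /\ Rbar_lt t b.

Definition smooth_on (a b : Rbar) (f : R -> R) : Prop :=
  forall (n : nat) (t : R), in_itv a b t -> ex_derive_n f n t.

Definition smooth_curve (a b : Rbar) (zeta : R -> point3) : Prop :=
  smooth_on a b (fun t => xc (zeta t)) /\
  smooth_on a b (fun t => yc (zeta t)) /\
  smooth_on a b (fun t => zc (zeta t)).

Definition velocity (zeta : R -> point3) (t : R) : point3 :=
  (Derive (fun s => xc (zeta s)) t,
   Derive (fun s => yc (zeta s)) t,
   Derive (fun s => zc (zeta s)) t).

(* [v] has coordinates [(u1, u2)] in the frame [(X1, X2)] at [p]. *)
Definition frame_coords (p v : point3) (u1 u2 : R) : Prop :=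
  v = plus (scal u1 (X1 p)) (scal u2 (X2 p)).

Definition horizontal (a b : Rbar) (zeta : R -> point3) : Prop :=
  forall t, in_itv a b t ->
    exists u1 u2, frame_coords (zeta t) (velocity zeta t) u1 u2.

Definition arc_length_param (a b : Rbar) (zeta : R -> point3) : Prop :=
  forall t, in_itv a b t ->
    exists u1 u2, frame_coords (zeta t) (velocity zeta t) u1 u2 /\
      sqrt (u1 ^ 2 + u2 ^ 2) = 1.

Definition char_deviation (zeta : R -> point3) (t : R) : R :=
  let x := fun s => xc (zeta s) in
  let y := fun s => yc (zeta s) in
  Derive x t * Derive_n y 2 t - Derive y t * Derive_n x 2 t.

Definition geodesic_curvature (zeta : R -> point3) (t : R) : R :=
  Derive (char_deviation zeta) t.

(* The constant [k] is required to be nonzero in the theorem: for [k = 0] the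
   projections are straight lines and circles, which are not Euler spirals. *)
Definition const_geodesic_curvature (a b : Rbar) (zeta : R -> point3)
    (k : R) : Prop :=
  forall t, in_itv a b t -> geodesic_curvature zeta t = k.

Definition euler_spiral (t : R) : point2 :=
  (RInt (fun u => cos (u ^ 2)) 0 t, RInt (fun u => sin (u ^ 2)) 0 t).

Definition rotation (theta : R) (p : point2) : point2 :=
  (cos theta * fst p - sin theta * snd p,
   sin theta * fst p + cos theta * snd p).

Definition translation (v p : point2) : point2 := plus p v.

(* Orthogonal reflection across the line through the origin that makes the
   angle [theta] with the x-axis. *)
Definition symmetry (theta : R) (p : point2) : point2 :=
  (cos (2 * theta) * fst p + sin (2 * theta) * snd p,
   sin (2 * theta) * fst p - cos (2 * theta) * snd p).

Definition dilation (r : R) (p : point2) : point2 := scal r p.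

Inductive plane_similarity : (point2 -> point2) -> Prop :=
| sim_rotation theta : plane_similarity (rotation theta)
| sim_translation v : plane_similarity (translation v)
| sim_symmetry theta : plane_similarity (symmetry theta)
| sim_dilation r : 0 < r -> plane_similarity (dilation r)
| sim_comp S T : plane_similarity S -> plane_similarity T ->
    plane_similarity (fun p => S (T p)).

Definition unit_speed (a b : Rbar) (gamma : R -> point2) : Prop :=
  forall t, in_itv a b t ->
    sqrt (Derive (fun s => fst (gamma s)) t ^ 2 +
          Derive (fun s => snd (gamma s)) t ^ 2) = 1.

(* Main.v *)
(** If [x'^2 + y'^2 = 1] and [h = x' y'' - y' x''], then [x'' = - h y'] and
    [y'' = h x'], so [(x', y')] is the unit vector of angle [theta + phi], where
    [phi] is a primitive of [h]. When [h' = k <> 0], [phi] is a quadratic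
    polynomial, and completing the square turns it into [sigma (c t + d)^2] up
    to a constant, with [sigma] the sign of [k]. Hence [(x', y')] is the velocity
    of the image of the Euler spiral under a rotation (preceded by a reflection
    when [sigma = -1]) and a dilation of ratio [1 / c]. Conversely, any plane
    curve has a horizontal lift, obtained by integrating
    [z' = (x y' - y x') / 2]. *)

Require Import Defs.
From Stdlib Require Import Reals Lra.
From Coquelicot Require Import Coquelicot.
Open Scope R_scope.

(** * Open intervals with possibly infinite ends *)

Lemma in_itv_locally (a b : Rbar) (t : R) :
  in_itv a b t -> locally t (in_itv a b).
Proof.
intros [Ha Hb].
apply filter_and.
- apply open_Rbar_gt; exact Ha.
- apply open_Rbar_lt; exact Hb.
Qed.

Lemma in_itv_between (a b : Rbar) (s t u : R) :
  in_itv a b s -> in_itv a b t -> s <= u <= t -> in_itv a b u.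
Proof.
intros [Ha _] [_ Hb] [Hsu Hut]; split.
- apply Rbar_lt_le_trans with s; simpl; trivial.
- apply Rbar_le_lt_trans with t; simpl; trivial.
Qed.

Lemma in_itv_inhabited (a b : Rbar) : Rbar_lt a b -> exists t, in_itv a b t.
Proof.
unfold in_itv; destruct a as [a| |], b as [b| |]; simpl; intros H; try easy.
- exists ((a + b) / 2); lra.
- exists (a + 1); lra.
- exists (b - 1); lra.
- exists 0; tauto.
Qed.

(** This is the uniqueness of primitives up to a constant; it yields the invariants of the rotating
    frame, the affine deviation and the final translation. *)
Lemma constant_of_derive_zero (a b : Rbar) (f : R -> R) :
  (forall t, in_itv a b t -> is_derive f t 0) ->
  forall s t, in_itv a b s -> in_itv a b t -> f s = f t.
Proof.
intros Hf.
assert (Hlt : forall s t, in_itv a b s -> in_itv a b t -> s < t -> f s = f t).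
{ intros s t Hs Ht Hst; apply eq_is_derive; trivial.
  intros u Hu; apply Hf, (in_itv_between a b s t); trivial. }
intros s t Hs Ht; destruct (Rtotal_order s t) as [H|[H|H]].
- auto.
- now subst.
- symmetry; auto.
Qed.

(** [auto_derive] leaves eta-expanded derivatives, which [rewrite] does not match. *)
Ltac rewrite_derive E :=
  match type of E with
  | is_derive ?f ?t ?l =>
      replace (Derive (fun x => f x) t) with l
        by (symmetry; exact (is_derive_unique f t l E))
  end.

(** * Unit vectors and normal form of plane similarities *)

Lemma cos2_sin2_pow (x : R) : cos x ^ 2 + sin x ^ 2 = 1.
Proof. generalize (sin2_cos2 x); unfold Rsqr; intros; nra. Qed.

(** The sine of [acos u] is nonnegative, so the angle is [acos u] or its opposite according to the
    sign of [v]. *)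
Lemma unit_vector_angle (u v : R) :
  u ^ 2 + v ^ 2 = 1 -> exists theta, u = cos theta /\ v = sin theta.
Proof.
intros H.
assert (Hu : -1 <= u <= 1) by nra.
assert (Hs : sin (acos u) = Rabs v).
{ rewrite sin_acos, <- sqrt_Rsqr_abs by trivial; f_equal; unfold Rsqr; nra. }
destruct (Rle_dec 0 v) as [Hv|Hv].
- exists (acos u).
  now rewrite Hs, cos_acos, Rabs_pos_eq.
- exists (- acos u).
  rewrite cos_neg, sin_neg, Hs, cos_acos, Rabs_left by lra; lra.
Qed.

(** Normal form of a similarity: a reflection across the x-axis when [sigma = -1], then the rotation
    of angle [theta], the dilation of ratio [r] and the translation by [v]. *)
Definition similarity_map (r theta sigma : R) (v p : point2) : point2 :=
  (r * (cos theta * fst p - sigma * sin theta * snd p) + fst v,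
   r * (sin theta * fst p + sigma * cos theta * snd p) + snd v).

Lemma translation_coords (v p : point2) :
  translation v p = (fst p + fst v, snd p + snd v).
Proof. reflexivity. Qed.

Lemma dilation_coords (r : R) (p : point2) :
  dilation r p = (r * fst p, r * snd p).
Proof. reflexivity. Qed.

Lemma plane_similarity_form (T : point2 -> point2) :
  plane_similarity T ->
  exists r theta sigma v, 0 < r /\ (sigma = 1 \/ sigma = -1) /\
    forall p, T p = similarity_map r theta sigma v p.
Proof.
unfold similarity_map.
induction 1 as [theta|v|theta|r Hr|S T _ IHS _ IHT].
- exists 1, theta, 1, (0, 0); repeat split; [lra|lra|].
  intros [p q]; unfold rotation; cbn [fst snd]; f_equal; ring.
- exists 1, 0, 1, v; repeat split; [lra|lra|].
  intros p; rewrite translation_coords, cos_0, sin_0; f_equal; ring.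
(* Reflecting across the line of angle [theta] is reflecting across the x-axis, then rotating by
   [2 * theta]. *)
- exists 1, (2 * theta), (-1), (0, 0); repeat split; [lra|lra|].
  intros [p q]; unfold symmetry; cbn [fst snd]; f_equal; ring.
- exists r, 0, 1, (0, 0); repeat split; [lra|lra|].
  intros p; rewrite dilation_coords, cos_0, sin_0; cbn [fst snd].
  f_equal; ring.
- destruct IHS as (r & theta & sigma & v & Hr & Hsigma & HS).
  destruct IHT as (r' & theta' & sigma' & v' & Hr' & Hsigma' & HT).
  (* An outer reflection reverses the inner rotation, hence the angle [theta + sigma * theta']; the
     new translation vector is the image of [v'] under the outer map. *)
  exists (r * r'), (theta + sigma * theta'), (sigma * sigma'),
    (similarity_map r theta sigma v v').
  split; [now apply Rmult_lt_0_compat|].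
  split; [destruct Hsigma, Hsigma'; subst; lra|].
  intros p; rewrite HT, HS; unfold similarity_map; cbn [fst snd].
  destruct Hsigma; subst sigma.
  + rewrite (Rmult_1_l theta'), cos_plus, sin_plus; f_equal; ring.
  + replace (theta + -1 * theta') with (theta - theta') by ring.
    rewrite cos_minus, sin_minus; f_equal; ring.
Qed.

Lemma similarity_map_plane_similarity (r theta sigma : R) (v : point2) :
  0 < r -> sigma = 1 \/ sigma = -1 ->
  exists T, plane_similarity T /\
    forall p, T p = similarity_map r theta sigma v p.
Proof.
intros Hr [->| ->].
- exists (fun p => translation v (dilation r (rotation theta p))); split.
  + apply sim_comp; [apply sim_translation|].
    apply sim_comp; [now apply sim_dilation|apply sim_rotation].
  + intros p; rewrite translation_coords, dilation_coords.
    unfold rotation, similarity_map; cbn [fst snd]; f_equal; ring.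
- exists (fun p => translation v (dilation r (symmetry (theta / 2) p))); split.
  + apply sim_comp; [apply sim_translation|].
    apply sim_comp; [now apply sim_dilation|apply sim_symmetry].
  + intros p; rewrite translation_coords, dilation_coords.
    unfold symmetry, similarity_map; replace (2 * (theta / 2)) with theta by field.
    cbn [fst snd]; f_equal; ring.
Qed.

(** * Velocity of the images of the Euler spiral *)

Lemma is_derive_RInt_continuous (f : R -> R) (t : R) :
  (forall u, continuous f u) -> is_derive (fun s => RInt f 0 s) t (f t).
Proof.
intros Hf; apply (is_derive_RInt f (fun s => RInt f 0 s) 0 t).
- apply filter_forall; intros s; apply (@RInt_correct R_CompleteNormedModule).
  apply (@ex_RInt_continuous R_CompleteNormedModule); auto.
- apply Hf.
Qed.

Lemma continuous_of_ex_derive (f : R -> R) (t : R) :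
  ex_derive f t -> continuous f t.
Proof. exact (@ex_derive_continuous R_AbsRing R_NormedModule f t). Qed.

Lemma is_derive_euler_spiral (t : R) :
  is_derive (fun s => fst (euler_spiral s)) t (cos (t ^ 2)) /\
  is_derive (fun s => snd (euler_spiral s)) t (sin (t ^ 2)).
Proof.
split; cbn [euler_spiral fst snd].
- apply (is_derive_RInt_continuous (fun u => cos (u ^ 2))).
  intros u; apply continuous_of_ex_derive; auto_derive; trivial.
- apply (is_derive_RInt_continuous (fun u => sin (u ^ 2))).
  intros u; apply continuous_of_ex_derive; auto_derive; trivial.
Qed.

(** The linear part of the similarity sends the unit vector of angle [w] to [r] times the one of
    angle [theta + sigma * w], and the chain rule contributes the factor [c]. *)
Lemma is_derive_similarity_euler_spiral (r theta sigma c d t : R) (v : point2) :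
  sigma = 1 \/ sigma = -1 ->
  is_derive (fun s => fst (similarity_map r theta sigma v (euler_spiral (c * s + d))))
    t (r * c * cos (theta + sigma * (c * t + d) ^ 2)) /\
  is_derive (fun s => snd (similarity_map r theta sigma v (euler_spiral (c * s + d))))
    t (r * c * sin (theta + sigma * (c * t + d) ^ 2)).
Proof.
intros Hsigma.
destruct (is_derive_euler_spiral (c * t + d)) as [H1 H2].
assert (H3 : is_derive (fun s => c * s + d) t c)
  by (auto_derive; [trivial|ring]).
set (e1 := fun s => fst (euler_spiral (c * s + d))).
set (e2 := fun s => snd (euler_spiral (c * s + d))).
assert (E1 : is_derive e1 t (c * cos ((c * t + d) ^ 2))).
{ exact (is_derive_comp (fun s => fst (euler_spiral s)) _ t _ _ H1 H3). }
assert (E2 : is_derive e2 t (c * sin ((c * t + d) ^ 2))).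
{ exact (is_derive_comp (fun s => snd (euler_spiral s)) _ t _ _ H2 H3). }
cbn [similarity_map fst snd].
set (w := (c * t + d) ^ 2) in *; clearbody w.
change (is_derive (fun s => r * (cos theta * e1 s - sigma * sin theta * e2 s)
                            + fst v) t (r * c * cos (theta + sigma * w)) /\
        is_derive (fun s => r * (sin theta * e1 s + sigma * cos theta * e2 s)
                            + snd v) t (r * c * sin (theta + sigma * w))).
(* Once opaque, [e1] and [e2] get their derivatives from [E1] and [E2] instead of being unfolded
   down to the integrals. *)
clearbody e1 e2.
assert (Ht : cos (theta + sigma * w) = cos theta * cos w - sigma * sin theta * sin w
          /\ sin (theta + sigma * w) = sin theta * cos w + sigma * cos theta * sin w).
{ destruct Hsigma; subst sigma.
  - rewrite Rmult_1_l, cos_plus, sin_plus; split; ring.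
  - replace (theta + -1 * w) with (theta - w) by ring.
    rewrite cos_minus, sin_minus; split; ring. }
destruct Ht as [-> ->].
split; auto_derive;
  try (repeat split; trivial; eexists; eassumption);
  rewrite_derive E1; rewrite_derive E2; ring.
Qed.

(** * Horizontality and arc length in coordinates *)

(** [X1] and [X2] project to the standard basis of the plane, so the first two components of [v]
    determine the coordinates, and the third gives the horizontality equation. *)
Lemma frame_coords_iff (p v : point3) (u1 u2 : R) :
  frame_coords p v u1 u2 <->
  xc v = u1 /\ yc v = u2 /\ zc v = (xc p * u2 - yc p * u1) / 2.
Proof.
destruct p as [[x y] z], v as [[v1 v2] v3].
change ((v1, v2, v3) = (u1 * 1 + u2 * 0, u1 * 0 + u2 * 1,
                        u1 * - (y / 2) + u2 * (x / 2)) <->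
        v1 = u1 /\ v2 = u2 /\ v3 = (x * u2 - y * u1) / 2).
split.
- intros E; injection E; intros; lra.
- intros (-> & -> & ->); f_equal; [f_equal|]; field.
Qed.

Lemma sqrt_sum_squares_eq_1 (u v : R) :
  sqrt (u ^ 2 + v ^ 2) = 1 <-> u ^ 2 + v ^ 2 = 1.
Proof.
split; intros H.
- rewrite <- (sqrt_sqrt (u ^ 2 + v ^ 2)) by nra; rewrite H; ring.
- rewrite H; apply sqrt_1.
Qed.

(** * From constant geodesic curvature to a quadratic angle *)

(** Turning [(p, q)] back by the angle [phi] cancels its rotation: the resulting unit vector
    [(A, B)] is constant, and [theta] is its angle. *)
Lemma rotating_unit_vector (a b : Rbar) (hab : Rbar_lt a b)
    (p q h phi : R -> R) :
  (forall t, in_itv a b t -> is_derive p t (- h t * q t)) ->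
  (forall t, in_itv a b t -> is_derive q t (h t * p t)) ->
  (forall t, in_itv a b t -> is_derive phi t (h t)) ->
  (forall t, in_itv a b t -> p t ^ 2 + q t ^ 2 = 1) ->
  exists theta, forall t, in_itv a b t ->
    p t = cos (theta + phi t) /\ q t = sin (theta + phi t).
Proof.
intros Hp Hq Hphi H1.
set (A := fun t => p t * cos (phi t) + q t * sin (phi t)).
set (B := fun t => q t * cos (phi t) - p t * sin (phi t)).
assert (HA : forall t, in_itv a b t -> is_derive A t 0).
{ intros t Ht; specialize (Hp t Ht); specialize (Hq t Ht);
    specialize (Hphi t Ht); unfold A; auto_derive.
  - repeat split; eexists; eassumption.
  - rewrite_derive Hp; rewrite_derive Hq; rewrite_derive Hphi; ring. }
assert (HB : forall t, in_itv a b t -> is_derive B t 0).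
{ intros t Ht; specialize (Hp t Ht); specialize (Hq t Ht);
    specialize (Hphi t Ht); unfold B; auto_derive.
  - repeat split; eexists; eassumption.
  - rewrite_derive Hp; rewrite_derive Hq; rewrite_derive Hphi; ring. }
destruct (in_itv_inhabited a b hab) as [t0 Ht0].
destruct (unit_vector_angle (A t0) (B t0)) as [theta [HcA HsB]].
{ unfold A, B.
  transitivity ((p t0 ^ 2 + q t0 ^ 2) * (cos (phi t0) ^ 2 + sin (phi t0) ^ 2));
    [ring|rewrite H1, cos2_sin2_pow; [ring|trivial]]. }
exists theta; intros t Ht.
(* By constancy [t0] may be replaced by [t]; turning [(A, B)] forward by [phi t] then recovers
   [(p, q)]. *)
rewrite cos_plus, sin_plus, <- HcA, <- HsB.
rewrite (constant_of_derive_zero a b A HA t0 t),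
  (constant_of_derive_zero a b B HB t0 t) by trivial.
unfold A, B; split.
- transitivity (p t * (cos (phi t) ^ 2 + sin (phi t) ^ 2));
    [rewrite cos2_sin2_pow; ring|ring].
- transitivity (q t * (cos (phi t) ^ 2 + sin (phi t) ^ 2));
    [rewrite cos2_sin2_pow; ring|ring].
Qed.

(** The deviation [h] has derivative [k], so it is affine, and the angle is a primitive of it. *)
Lemma affine_curvature_angle (a b : Rbar) (hab : Rbar_lt a b)
    (x y : R -> R) (k : R) :
  smooth_on a b x -> smooth_on a b y ->
  (forall t, in_itv a b t -> Derive x t ^ 2 + Derive y t ^ 2 = 1) ->
  (forall t, in_itv a b t ->
     Derive (fun s => Derive x s * Derive_n y 2 s - Derive y s * Derive_n x 2 s) t
       = k) ->
  exists theta m, forall t, in_itv a b t ->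
    Derive x t = cos (theta + (k / 2 * t ^ 2 + m * t)) /\
    Derive y t = sin (theta + (k / 2 * t ^ 2 + m * t)).
Proof.
intros Hx Hy H1 Hk.
set (h := fun s => Derive x s * Derive_n y 2 s - Derive y s * Derive_n x 2 s) in *.
(* [ex_derive_n f n] asks that the derivative of order [n - 1] be differentiable: order 2 is needed
   to differentiate [Derive x], and order 3 to differentiate the second derivatives inside [h]. *)
assert (Dx1 : forall t, in_itv a b t -> is_derive (Derive x) t (Derive_n x 2 t))
  by (intros t Ht; exact (Derive_correct _ _ (Hx 2%nat t Ht))).
assert (Dy1 : forall t, in_itv a b t -> is_derive (Derive y) t (Derive_n y 2 t))
  by (intros t Ht; exact (Derive_correct _ _ (Hy 2%nat t Ht))).
assert (Dh : forall t, in_itv a b t -> is_derive h t k).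
{ intros t Ht; rewrite <- (Hk t Ht); apply Derive_correct.
  apply (ex_derive_minus (fun s => Derive x s * Derive_n y 2 s)
           (fun s => Derive y s * Derive_n x 2 s)); apply ex_derive_mult.
  - exact (Hx 2%nat t Ht).
  - exact (Hy 3%nat t Ht).
  - exact (Hy 2%nat t Ht).
  - exact (Hx 3%nat t Ht). }
(* Differentiating the unit-speed identity, valid near each point of the open interval, shows that
   acceleration is orthogonal to velocity. *)
assert (Horth : forall t, in_itv a b t ->
          Derive x t * Derive_n x 2 t + Derive y t * Derive_n y 2 t = 0).
{ intros t Ht.
  assert (E : is_derive (fun s => Derive x s ^ 2 + Derive y s ^ 2) t
                (2 * (Derive x t * Derive_n x 2 t + Derive y t * Derive_n y 2 t))).
  { specialize (Dx1 t Ht); specialize (Dy1 t Ht).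
    set (x1 := Derive x) in *; set (y1 := Derive y) in *.
    set (x2 := Derive_n x 2 t) in *; set (y2 := Derive_n y 2 t) in *.
    clearbody x1 y1 x2 y2; auto_derive.
    - repeat split; eexists; eassumption.
    - rewrite_derive Dx1; rewrite_derive Dy1; ring. }
  assert (E0 : is_derive (fun s => Derive x s ^ 2 + Derive y s ^ 2) t 0).
  { apply is_derive_ext_loc with (fun _ : R => 1).
    - generalize (in_itv_locally a b t Ht); apply filter_imp.
      intros s Hs; symmetry; auto.
    - auto_derive; trivial. }
  apply is_derive_unique in E; apply is_derive_unique in E0.
  rewrite E0 in E; lra. }
destruct (in_itv_inhabited a b hab) as [t0 Ht0].
set (m := h t0 - k * t0).
assert (Hh : forall t, in_itv a b t -> h t = k * t + m).
{ intros t Ht.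
  assert (E : h t - k * t = h t0 - k * t0).
  { apply (constant_of_derive_zero a b (fun s => h s - k * s)); trivial.
    intros s Hs; specialize (Dh s Hs); clearbody h; auto_derive.
    - repeat split; eexists; eassumption.
    - rewrite_derive Dh; ring. }
  unfold m; lra. }
destruct (rotating_unit_vector a b hab (Derive x) (Derive y) h
            (fun t => k / 2 * t ^ 2 + m * t)) as [theta Htheta]; trivial.
- intros t Ht; replace (- h t * Derive y t) with (Derive_n x 2 t); [auto|].
  specialize (H1 t Ht); specialize (Horth t Ht); unfold h.
  (* Removing from the acceleration its component along the velocity, which is zero, leaves the
     normal part, and this expands to [- h t * Derive y t]. *)
  transitivity (Derive_n x 2 t * (Derive x t ^ 2 + Derive y t ^ 2)
                - Derive x t * (Derive x t * Derive_n x 2 t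
                                + Derive y t * Derive_n y 2 t));
    [rewrite H1, Horth|]; ring.
- intros t Ht; replace (h t * Derive x t) with (Derive_n y 2 t); [auto|].
  specialize (H1 t Ht); specialize (Horth t Ht); unfold h.
  transitivity (Derive_n y 2 t * (Derive x t ^ 2 + Derive y t ^ 2)
                - Derive y t * (Derive x t * Derive_n x 2 t
                                + Derive y t * Derive_n y 2 t));
    [rewrite H1, Horth|]; ring.
- intros t Ht; rewrite (Hh t Ht); auto_derive; [trivial|field].
- exists theta, m; exact Htheta.
Qed.

(** With [sigma] the sign of [k], the equation [sigma * c ^ 2 = k / 2] has a positive solution [c];
    the other constants come from [k / 2 * (t + m / k) ^ 2]. *)
Lemma complete_square (k m : R) :
  k <> 0 ->
  exists sigma c d e, (sigma = 1 \/ sigma = -1) /\ 0 < c /\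
    forall t, k / 2 * t ^ 2 + m * t = sigma * (c * t + d) ^ 2 + e.
Proof.
intros Hk.
assert (H : exists sigma, (sigma = 1 \/ sigma = -1) /\ 0 < sigma * k / 2).
{ destruct (Rdichotomy k 0 Hk); [exists (-1)|exists 1]; split; lra. }
destruct H as (sigma & Hsigma & Hpos).
set (c := sqrt (sigma * k / 2)).
assert (Hc : c * c = sigma * k / 2) by (apply sqrt_sqrt; lra).
assert (Hs : sigma * sigma = 1) by (destruct Hsigma; subst; ring).
exists sigma, c, (c * m / k), (- (m ^ 2 / (2 * k))).
split; [trivial|split; [now apply sqrt_lt_R0|]].
intros t.
transitivity (sigma * (c * c) * (t + m / k) ^ 2 - m ^ 2 / (2 * k)); [|field; trivial].
rewrite Hc.
transitivity (sigma * sigma * k / 2 * (t + m / k) ^ 2 - m ^ 2 / (2 * k));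
  [rewrite Hs|]; field; trivial.
Qed.

(** * Smoothness and horizontal lifts *)

(** A class of functions closed under differentiation, hence consisting of
    smooth functions. *)
Inductive elementary : (R -> R) -> Prop :=
| elem_const c : elementary (fun _ => c)
| elem_id : elementary (fun t => t)
| elem_plus f g : elementary f -> elementary g -> elementary (fun t => f t + g t)
| elem_mult f g : elementary f -> elementary g -> elementary (fun t => f t * g t)
| elem_cos f : elementary f -> elementary (fun t => cos (f t))
| elem_sin f : elementary f -> elementary (fun t => sin (f t))
| elem_primitive f F :
    elementary f -> (forall t, is_derive F t (f t)) -> elementary F.

Lemma elementary_derive (f : R -> R) :
  elementary f -> exists g, elementary g /\ forall t, is_derive f t (g t).
Proof.
induction 1 as [c| |f g Hf [f' [Ef Df]] Hg [g' [Eg Dg]]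
               |f g Hf [f' [Ef Df]] Hg [g' [Eg Dg]]
               |f Hf [f' [Ef Df]]|f Hf [f' [Ef Df]]|f F Hf _ HF].
- exists (fun _ => 0); split; [constructor|].
  intros t; auto_derive; trivial.
- exists (fun _ => 1); split; [constructor|].
  intros t; auto_derive; trivial.
- exists (fun t => f' t + g' t); split; [now constructor|].
  intros t; exact (is_derive_plus f g t _ _ (Df t) (Dg t)).
- exists (fun t => f' t * g t + f t * g' t); split.
  + apply elem_plus; now apply elem_mult.
  + intros t; specialize (Df t); specialize (Dg t); auto_derive.
    * repeat split; eexists; eassumption.
    * rewrite_derive Df; rewrite_derive Dg; ring.
- exists (fun t => f' t * (-1 * sin (f t))); split.
  + apply elem_mult; [trivial|].
    apply elem_mult; [apply elem_const|now apply elem_sin].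
  + intros t; specialize (Df t); auto_derive.
    * eexists; eassumption.
    * rewrite_derive Df; ring.
- exists (fun t => f' t * cos (f t)); split.
  + apply elem_mult; [trivial|now apply elem_cos].
  + intros t; specialize (Df t); auto_derive.
    * eexists; eassumption.
    * rewrite_derive Df; ring.
- now exists f.
Qed.

Lemma elementary_smooth (a b : Rbar) (f : R -> R) :
  elementary f -> smooth_on a b f.
Proof.
intros Hf.
assert (H : forall n, exists g, elementary g /\ forall t, Derive_n f n t = g t).
{ induction n as [|n [g [Eg Hg]]].
  - now exists f.
  - destruct (elementary_derive g Eg) as [g' [Eg' Dg']].
    exists g'; split; [trivial|intros t; simpl].
    rewrite (Derive_ext _ _ t Hg); now apply is_derive_unique. }
intros [|n] t _; simpl; [trivial|].
destruct (H n) as [g [Eg Hg]].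
apply ex_derive_ext with g; [now intros; symmetry|].
destruct (elementary_derive g Eg) as [g' [_ Dg']]; now exists (g' t).
Qed.

(** The deviation is [eps ^ 2 = 1] times the derivative of the angle, namely
    [2 * sigma * c * (c * t + d)], whence the curvature. The factor [eps] allows for a
    reparametrization that reverses orientation. *)
Lemma horizontal_lift_of_unit_angle (a b : Rbar) (x y : R -> R)
    (eps theta sigma c d : R) :
  (forall t, is_derive x t (eps * cos (theta + sigma * (c * t + d) ^ 2))) ->
  (forall t, is_derive y t (eps * sin (theta + sigma * (c * t + d) ^ 2))) ->
  eps ^ 2 = 1 ->
  exists zeta : R -> point3,
    smooth_curve a b zeta /\ horizontal a b zeta /\ arc_length_param a b zeta /\
    const_geodesic_curvature a b zeta (2 * sigma * c ^ 2) /\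
    forall t, proj_xy (zeta t) = (x t, y t).
Proof.
intros Dx Dy Heps.
set (psi := fun t => theta + sigma * (c * t + d) ^ 2).
set (x1 := fun t => eps * cos (psi t)); set (y1 := fun t => eps * sin (psi t)).
assert (Epsi : elementary psi).
{ apply elem_plus; [apply elem_const|].
  apply elem_mult; [apply elem_const|].
  assert (E : elementary (fun t => c * t + d)).
  { apply elem_plus; [apply elem_mult; constructor|constructor]. }
  apply elem_mult; [trivial|apply elem_mult; [trivial|constructor]]. }
assert (Ex1 : elementary x1) by (apply elem_mult; [|apply elem_cos]; trivial; constructor).
assert (Ey1 : elementary y1) by (apply elem_mult; [|apply elem_sin]; trivial; constructor).
(* The coordinates are Fresnel-type integrals, so they enter the class as primitives. *)
assert (Ex : elementary x) by (apply elem_primitive with x1; trivial).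
assert (Ey : elementary y) by (apply elem_primitive with y1; trivial).
(* This is [(x y' - y x') / 2], written with sums and products only so as to be visibly
   elementary. *)
set (z1 := fun t => x t * (/ 2 * y1 t) + y t * (- / 2 * x1 t)).
assert (Ez1 : elementary z1).
{ apply elem_plus; apply elem_mult; trivial; apply elem_mult; trivial; constructor. }
set (z := fun t => RInt z1 0 t).
assert (Dz : forall t, is_derive z t (z1 t)).
{ intros t; apply is_derive_RInt_continuous.
  intros u; destruct (elementary_derive z1 Ez1) as [z2 [_ Dz1]].
  apply continuous_of_ex_derive; now exists (z2 u). }
assert (Ez : elementary z) by (apply elem_primitive with z1; trivial).
assert (Hframe : forall t,
          frame_coords (x t, y t, z t)
            (velocity (fun s => (x s, y s, z s)) t) (x1 t) (y1 t)).
{ intros t; apply frame_coords_iff.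
  cbv [velocity xc yc zc fst snd].
  change (Derive x t = x1 t /\ Derive y t = y1 t /\
          Derive z t = (x t * y1 t - y t * x1 t) / 2).
  rewrite (is_derive_unique _ _ _ (Dx t)), (is_derive_unique _ _ _ (Dy t)),
    (is_derive_unique _ _ _ (Dz t)).
  repeat split; unfold z1; field. }
exists (fun t => (x t, y t, z t)); repeat split.
- exact (elementary_smooth a b x Ex).
- exact (elementary_smooth a b y Ey).
- exact (elementary_smooth a b z Ez).
- intros t _; exists (x1 t), (y1 t); apply Hframe.
- intros t _; exists (x1 t), (y1 t); split; [apply Hframe|].
  apply sqrt_sum_squares_eq_1; unfold x1, y1.
  transitivity (eps ^ 2 * (cos (psi t) ^ 2 + sin (psi t) ^ 2)); [ring|].
  rewrite Heps, cos2_sin2_pow; ring.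
- intros t _; unfold geodesic_curvature.
  assert (Hdev : forall s, char_deviation (fun t => (x t, y t, z t)) s
                   = 2 * sigma * c * (c * s + d)).
  { intros s; unfold char_deviation.
    change (Derive x s * Derive (Derive y) s - Derive y s * Derive (Derive x) s
            = 2 * sigma * c * (c * s + d)).
    rewrite (Derive_ext (Derive y) y1) by (intros; now apply is_derive_unique).
    rewrite (Derive_ext (Derive x) x1) by (intros; now apply is_derive_unique).
    rewrite (is_derive_unique _ _ _ (Dx s)), (is_derive_unique _ _ _ (Dy s)).
    replace (Derive y1 s) with (2 * sigma * c * (c * s + d) * x1 s).
    2: { symmetry; apply is_derive_unique; unfold y1, x1, psi;
           auto_derive; [trivial|simpl; ring]. }
    replace (Derive x1 s) with (- (2 * sigma * c * (c * s + d)) * y1 s).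
    2: { symmetry; apply is_derive_unique; unfold y1, x1, psi;
           auto_derive; [trivial|simpl; ring]. }
    unfold x1, y1; fold (psi s).
    transitivity (2 * sigma * c * (c * s + d) * eps ^ 2
                  * (cos (psi s) ^ 2 + sin (psi s) ^ 2)); [ring|].
    rewrite Heps, cos2_sin2_pow; ring. }
  rewrite (Derive_ext _ _ t Hdev); apply is_derive_unique.
  auto_derive; [trivial|ring].
Qed.

(** * Projections of constant-curvature curves and Euler spirals *)

Theorem corollary5p8 (a b : Rbar) (hab : Rbar_lt a b) (gamma : R -> point2) :
  (exists (zeta : R -> point3) (k : R),
     smooth_curve a b zeta /\ horizontal a b zeta /\
     arc_length_param a b zeta /\
     k <> 0 /\ const_geodesic_curvature a b zeta k /\
     (forall t, in_itv a b t -> gamma t = proj_xy (zeta t)))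
  <->
  (exists (T : point2 -> point2) (c d : R),
     plane_similarity T /\ c <> 0 /\
     (forall t, in_itv a b t -> gamma t = T (euler_spiral (c * t + d))) /\
     unit_speed a b gamma).
Proof.
split.
- intros (zeta & k & (Hx & Hy & _) & _ & Harc & Hk & Hcurv & Hgamma).
  set (x := fun t => xc (zeta t)) in *; set (y := fun t => yc (zeta t)) in *.
  assert (H1 : forall t, in_itv a b t -> Derive x t ^ 2 + Derive y t ^ 2 = 1).
  { intros t Ht; destruct (Harc t Ht) as (u1 & u2 & Hf & Hu).
    apply frame_coords_iff in Hf; destruct Hf as (E1 & E2 & _).
    change (Derive x t = u1) in E1; change (Derive y t = u2) in E2.
    rewrite E1, E2; now apply sqrt_sum_squares_eq_1. }
  destruct (affine_curvature_angle a b hab x y k Hx Hy H1 Hcurv)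
    as (theta & m & Hangle).
  destruct (complete_square k m Hk) as (sigma & c & d & e & Hsigma & Hc & Hsq).
  assert (Hr : 0 < / c) by now apply Rinv_0_lt_compat.
  (* The ratio [/ c] compensates the factor [c] of the reparametrization. The translation [v] stays
     free, since the velocity does not depend on it. *)
  pose (S := fun v t => similarity_map (/ c) (theta + e) sigma v
                          (euler_spiral (c * t + d))).
  assert (DS : forall v t, in_itv a b t ->
            is_derive (fun s => fst (S v s)) t (Derive x t) /\
            is_derive (fun s => snd (S v s)) t (Derive y t)).
  { intros v t Ht; destruct (Hangle t Ht) as [-> ->].
    rewrite Hsq.
    replace (theta + (sigma * (c * t + d) ^ 2 + e))
      with (theta + e + sigma * (c * t + d) ^ 2) by ring.
    destruct (is_derive_similarity_euler_spiral (/ c) (theta + e) sigma c d t v Hsigma)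
      as [D1 D2].
    rewrite Rinv_l, Rmult_1_l in D1, D2 by lra; now split. }
  destruct (in_itv_inhabited a b hab) as [t0 Ht0].
  (* This translation makes both curves agree at [t0]; having equal velocities, they then agree on
     the whole interval. *)
  set (v := (x t0 - fst (S (0, 0) t0), y t0 - snd (S (0, 0) t0))).
  assert (Hgs : forall t, in_itv a b t -> gamma t = S v t).
  { intros t Ht; rewrite (Hgamma t Ht).
    assert (E1 : x t - fst (S (0, 0) t) = x t0 - fst (S (0, 0) t0)).
    { apply (constant_of_derive_zero a b (fun s => x s - fst (S (0, 0) s))); trivial.
      intros s Hs; rewrite <- (Rminus_diag (Derive x s)).
      refine (is_derive_minus _ _ s _ _ _ (proj1 (DS _ s Hs))).
      exact (Derive_correct _ _ (Hx 1%nat s Hs)). }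
    assert (E2 : y t - snd (S (0, 0) t) = y t0 - snd (S (0, 0) t0)).
    { apply (constant_of_derive_zero a b (fun s => y s - snd (S (0, 0) s))); trivial.
      intros s Hs; rewrite <- (Rminus_diag (Derive y s)).
      refine (is_derive_minus _ _ s _ _ _ (proj2 (DS _ s Hs))).
      exact (Derive_correct _ _ (Hy 1%nat s Hs)). }
    change (proj_xy (zeta t)) with (x t, y t).
    unfold S, similarity_map; unfold v; cbn [fst snd].
    rewrite <- E1, <- E2; unfold S, similarity_map; cbn [fst snd].
    f_equal; ring. }
  destruct (similarity_map_plane_similarity (/ c) (theta + e) sigma v Hr Hsigma)
    as (T & HT & ET).
  exists T, c, d; repeat split; [trivial|lra| |].
  + intros t Ht; rewrite ET; now apply Hgs.
  + intros t Ht; apply sqrt_sum_squares_eq_1.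
    assert (Hloc : locally t (fun s => S v s = gamma s)).
    { generalize (in_itv_locally a b t Ht); apply filter_imp.
      intros s Hs; symmetry; auto. }
    rewrite <- (H1 t Ht); destruct (DS v t Ht) as [D1 D2].
    f_equal; f_equal; apply is_derive_unique.
    * eapply is_derive_ext_loc; [|exact D1].
      generalize Hloc; apply filter_imp; now intros s ->.
    * eapply is_derive_ext_loc; [|exact D2].
      generalize Hloc; apply filter_imp; now intros s ->.
- intros (T & c & d & HT & Hc & Hgamma & Hspeed).
  destruct (plane_similarity_form T HT) as (r & theta & sigma & v & Hr & Hsigma & ET).
  (* [gamma] is prescribed only on the interval, so the lift is built over the spiral formula, which
     is defined on the whole line. *)
  set (x := fun t => fst (similarity_map r theta sigma v (euler_spiral (c * t + d)))).
  set (y := fun t => snd (similarity_map r theta sigma v (euler_spiral (c * t + d)))).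
  assert (Dx : forall t, is_derive x t (r * c * cos (theta + sigma * (c * t + d) ^ 2)))
    by (intros t; now apply is_derive_similarity_euler_spiral).
  assert (Dy : forall t, is_derive y t (r * c * sin (theta + sigma * (c * t + d) ^ 2)))
    by (intros t; now apply is_derive_similarity_euler_spiral).
  assert (Hxy : forall t, in_itv a b t -> gamma t = (x t, y t)).
  { intros t Ht; rewrite (Hgamma t Ht), ET; apply surjective_pairing. }
  (* The spiral image has constant speed, so unit speed at one point of the interval gives
     [r * c = 1] or [r * c = -1], as [c] may be negative. *)
  assert (Heps : (r * c) ^ 2 = 1).
  { destruct (in_itv_inhabited a b hab) as [t Ht].
    assert (Hloc : locally t (fun s => gamma s = (x s, y s))).
    { generalize (in_itv_locally a b t Ht); apply filter_imp; auto. }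
    specialize (Hspeed t Ht); apply sqrt_sum_squares_eq_1 in Hspeed.
    rewrite (Derive_ext_loc (fun s => fst (gamma s)) x),
      (Derive_ext_loc (fun s => snd (gamma s)) y) in Hspeed.
    2, 3: generalize Hloc; apply filter_imp; now intros s ->.
    rewrite (is_derive_unique _ _ _ (Dx t)), (is_derive_unique _ _ _ (Dy t)) in Hspeed.
    rewrite <- Hspeed, 2!(Rpow_mult_distr (r * c)), <- Rmult_plus_distr_l,
      cos2_sin2_pow; ring. }
  destruct (horizontal_lift_of_unit_angle a b x y (r * c) theta sigma c d Dx Dy Heps)
    as (zeta & Hsm & Hhor & Harc & Hcurv & Hproj).
  exists zeta, (2 * sigma * c ^ 2); repeat split; trivial; try apply Hsm.
  + assert (Hc2 : c ^ 2 <> 0) by now apply pow_nonzero.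
    destruct Hsigma; subst sigma; lra.
  + intros t Ht; rewrite Hproj; auto.
Qed.
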